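(* Let $a\ge1$ and $q\ge0$ be integers. For every $m\ge3$, $$L_{m,\mathrm{cyc}}^{(a)}(q)=\operatorname{tr}\bigl((C_q^{(a)})^m\bigr).$$ With $Q_q^{(a)}(y)=\det(I-yC_q^{(a)})$, the closed-walk generating function satisfies $$\Omega_q^{(a)}(y):=\sum_{m\ge1}\operatorname{tr}\bigl((C_q^{(a)})^m\bigr)\,y^{m-1}=-\frac{d}{dy}\log Q_q^{(a)}(y)=-\frac{(Q_q^{(a)})'(y)}{Q_q^{(a)}(y)}.$$ Consequently, $$\sum_{m\ge3}L_{m,\mathrm{cyc}}^{(a)}(q)\,y^{m-3}=\frac{\Omega_q^{(a)}(y)-T_1-T_2\,y}{y^2},\qquad T_1=\operatorname{tr}(C_q^{(a)}),\quad T_2=\operatorname{tr}\bigl((C_q^{(a)})^2\bigr).$$ Thus the closed-walk generating function $\Omega_q^{(a)}(y)$ has the same visible denominator $Q_q^{(a)}(y)$ as the path generating function $\mathcal F_q^{(a)}(y)$, and its visible numerator (that is, $Q_q^{(a)}(y)\,\Omega_q^{(a)}(y)$, with no cancellation performed) is $$N_{q,\mathrm{cyc}}^{(a)}(y)=-(Q_q^{(a)})'(y).$$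
   Context: For integers $a\ge1$ and $m\ge1$ let $x=(x_{i,j})_{1\le i\le m,\,1\le j\le a}\in\mathbb R^{am}$ and $R_i=x_{i,1}+\cdots+x_{i,a}$. For $m\ge3$ the cyclic block polytope is $\mathcal C_m^{(a)}=\{x\in\mathbb R_{\ge0}^{am}: R_i+R_{i+1}\le1,\ i\in\mathbb Z/m\mathbb Z\}$ (indices read cyclically), and $L_{m,\mathrm{cyc}}^{(a)}(q)=\#(q\,\mathcal C_m^{(a)}\cap\mathbb Z^{am})$ for integers $q\ge0$. The matrix $C_q^{(a)}$ is the $(q+1)\times(q+1)$ matrix indexed by $0\le r,s\le q$ with $(C_q^{(a)})_{r,s}=\binom{s+a-1}{a-1}$ if $r+s\le q$ and $0$ otherwise. Generating functions are formal power series in $y$. The path generating function is $\mathcal F_q^{(a)}(y)=\sum_{m\ge1}L_m^{(a)}(q)y^{m-1}$, where $L_m^{(a)}(q)=\#(q\mathcal P_m^{(a)}\cap\mathbb Z^{am})$, $\mathcal P_m^{(a)}=\{x\in\mathbb R_{\ge0}^{am}: R_i+R_{i+1}\le1,\ 1\le i\le m-1\}$ for $m\ge2$ and $\mathcal P_1^{(a)}=\{x\in\mathbb R_{\ge0}^{a}:R_1\le1\}$. Its visible denominator is by definition $Q_q^{(a)}(y)=\det(I-yC_q^{(a)})$, i.e. one writes $\mathcal F_q^{(a)}=P_q^{(a)}/Q_q^{(a)}$ with $P_q^{(a)}$ a polynomial, not necessarily in lowest terms. *)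

(* Defs.v *)
From HB Require Import structures.
From mathcomp Require Import all_boot all_order all_algebra.
From mathcomp Require Import finmap.
From mathcomp Require Import mathcomp_extra boolp classical_sets functions.
From mathcomp Require Import cardinality reals.

Set Implicit Arguments.
Unset Strict Implicit.
Unset Printing Implicit Defensive.

Import Order.TTheory GRing.Theory Num.Theory.
Local Open Scope classical_set_scope.
Local Open Scope ring_scope.

(* A wrapper around [nat -> F]: the bare function type already carries the
   pointwise product, whereas series are multiplied by convolution. *)
Record fps (F : fieldType) := FPS { fps_coef : nat -> F }.

HB.instance Definition _ (F : fieldType) := gen_eqMixin (fps F).
HB.instance Definition _ (F : fieldType) := gen_choiceMixin (fps F).

Section FpsRing.
Variable F : fieldType.
Implicit Types (f g h : fps F) (p : {poly F}) (n i k : nat).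

Lemma fpsP f g : (forall n, fps_coef f n = fps_coef g n) -> f = g.
Proof. by case: f g => [u] [v] /= /funext ->. Qed.

Definition fps_of_poly p : fps F := FPS (fun n => p`_n).

Definition fps_zero : fps F := FPS (fun=> 0).
Definition fps_opp f : fps F := FPS (fun n => - fps_coef f n).
Definition fps_add f g : fps F := FPS (fun n => fps_coef f n + fps_coef g n).
Definition fps_one : fps F := FPS (fun n => (n == 0%N)%:R).
Definition fps_mul f g : fps F :=
  FPS (fun n => \sum_(i < n.+1) fps_coef f i * fps_coef g (n - i)%N).

Let fps_addA : associative fps_add.
Proof. by move=> f g h; apply: fpsP => n /=; rewrite addrA. Qed.
Let fps_addC : commutative fps_add.
Proof. by move=> f g; apply: fpsP => n /=; rewrite addrC. Qed.
Let fps_add0 : left_id fps_zero fps_add.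
Proof. by move=> f; apply: fpsP => n /=; rewrite add0r. Qed.
Let fps_addN : left_inverse fps_zero fps_opp fps_add.
Proof. by move=> f; apply: fpsP => n /=; rewrite addNr. Qed.

HB.instance Definition _ :=
  GRing.isZmodule.Build (fps F) fps_addA fps_addC fps_add0 fps_addN.

Let trunc n f : {poly F} := \poly_(i < n.+1) fps_coef f i.

Let truncE n f i : (i <= n)%N -> fps_coef f i = (trunc n f)`_i.
Proof. by move=> le_in; rewrite coef_poly ltnS le_in. Qed.

Let fps_mul_poly n f g (p r : {poly F}) :
    (forall i, (i <= n)%N -> fps_coef f i = p`_i) ->
    (forall i, (i <= n)%N -> fps_coef g i = r`_i) ->
  forall i, (i <= n)%N -> fps_coef (fps_mul f g) i = (p * r)`_i.
Proof.
move=> fp gr i le_in; rewrite coefM /=; apply: eq_bigr => j _.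
rewrite fp ?gr //; first exact: leq_trans (leq_subr _ _) le_in.
by apply: leq_trans le_in; rewrite -ltnS.
Qed.

Let fps_mulA : associative fps_mul.
Proof.
move=> f g h; apply: fpsP => n.
have Tf := @truncE n f; have Tg := @truncE n g; have Th := @truncE n h.
rewrite (fps_mul_poly Tf (fps_mul_poly Tg Th)) //.
by rewrite (fps_mul_poly (fps_mul_poly Tf Tg) Th) // mulrA.
Qed.
Let fps_mulC : commutative fps_mul.
Proof.
move=> f g; apply: fpsP => n.
have Tf := @truncE n f; have Tg := @truncE n g.
by rewrite (fps_mul_poly Tf Tg) // (fps_mul_poly Tg Tf) // mulrC.
Qed.
Let fps_mul1 : left_id fps_one fps_mul.
Proof.
move=> f; apply: fpsP => n /=; rewrite big_ord_recl /= mul1r subn0.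
by rewrite big1 ?addr0 // => i _; rewrite mul0r.
Qed.
Let fps_mulDl : left_distributive fps_mul fps_add.
Proof.
move=> f g h; apply: fpsP => n /=; rewrite -big_split /=.
by apply: eq_bigr => i _; rewrite mulrDl.
Qed.
Let fps_one_neq0 : fps_one != 0.
Proof.
apply/eqP => /(congr1 (fun f => fps_coef f 0%N)) /= /eqP.
by rewrite oner_eq0.
Qed.

HB.instance Definition _ := GRing.Zmodule_isComNzRing.Build (fps F)
  fps_mulA fps_mulC fps_mul1 fps_mulDl fps_one_neq0.

Lemma fps_coef0 n : fps_coef (0 : fps F) n = 0. Proof. by []. Qed.
Lemma fps_coefN f n : fps_coef (- f) n = - fps_coef f n. Proof. by []. Qed.
Lemma fps_coefD f g n : fps_coef (f + g) n = fps_coef f n + fps_coef g n.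
Proof. by []. Qed.
Lemma fps_coef1 n : fps_coef (1 : fps F) n = (n == 0%N)%:R. Proof. by []. Qed.
Lemma fps_coefM f g n :
  fps_coef (f * g) n = \sum_(i < n.+1) fps_coef f i * fps_coef g (n - i)%N.
Proof. by []. Qed.

Lemma fps_of_poly_is_zmod_morphism : zmod_morphism fps_of_poly.
Proof. by move=> p r; apply: fpsP => n; rewrite /= coefB. Qed.
HB.instance Definition _ := GRing.isZmodMorphism.Build
  {poly F} (fps F) fps_of_poly fps_of_poly_is_zmod_morphism.

Lemma fps_of_poly_is_monoid_morphism : monoid_morphism fps_of_poly.
Proof.
split=> [|p r]; apply: fpsP => n; first by rewrite /= coef1.
by rewrite /= coefM.
Qed.
HB.instance Definition _ := GRing.isMonoidMorphism.Build
  {poly F} (fps F) fps_of_poly fps_of_poly_is_monoid_morphism.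

(* The first [n] coefficients of the inverse of [f], from the recursion
   [f_0 * g_n = - \sum_(1 <= i <= n) f_i * g_(n - i)], [f_0 * g_0 = 1]. *)
Fixpoint fps_inv_seq f n : seq F :=
  if n isn't n'.+1 then [::] else
  let s := fps_inv_seq f n' in
  rcons s ((fps_coef f 0)^-1 *
    ((n' == 0%N)%:R - \sum_(i < n') fps_coef f i.+1 * s`_(n' - i.+1)%N)).

Definition fps_unit : pred (fps F) := fun f => fps_coef f 0 != 0.

Definition fps_inv f : fps F :=
  if fps_unit f then FPS (fun n => (fps_inv_seq f n.+1)`_n) else f.

Let size_inv_seq f n : size (fps_inv_seq f n) = n.
Proof. by elim: n => //= n IHn; rewrite size_rcons IHn. Qed.

Let nth_inv_seq f n i :
  (i < n)%N -> (fps_inv_seq f n)`_i = (fps_inv_seq f i.+1)`_i.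
Proof.
elim: n => // n IHn; rewrite ltnS leq_eqVlt => /orP[/eqP-> // | lt_in].
by rewrite [LHS]/= nth_rcons size_inv_seq lt_in IHn.
Qed.

Let fps_mulV : {in fps_unit, left_inverse 1 fps_inv *%R}.
Proof.
move=> f; rewrite /in_mem /= => Uf; rewrite mulrC; apply: fpsP => n.
rewrite -[RHS]/((n == 0%N)%:R) fps_coefM /fps_inv Uf big_ord_recl /= subn0.
rewrite nth_rcons size_inv_seq ltnn eqxx mulrA mulfV // mul1r.
rewrite [X in _ + X](_ : _ =
    \sum_(i < n) fps_coef f i.+1 * (fps_inv_seq f n)`_(n - i.+1)) ?subrK //.
apply: eq_bigr => i _; rewrite (@nth_inv_seq f n) //.
by rewrite ltn_subrL /= (leq_ltn_trans _ (ltn_ord i)).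
Qed.
Let fps_unitP f g : g * f = 1 -> fps_unit f.
Proof.
move=> /(congr1 (fun h => fps_coef h 0%N)).
rewrite fps_coefM big_ord1 subnn fps_coef1 eqxx /fps_unit => gf1.
by apply: contra_eq_neq gf1 => ->; rewrite mulr0 eq_sym oner_eq0.
Qed.
Let fps_inv_out : {in [predC fps_unit], fps_inv =1 id}.
Proof. by move=> f; rewrite inE /= /in_mem /= /fps_inv => /negbTE ->. Qed.

HB.instance Definition _ := GRing.ComNzRing_hasMulInverse.Build (fps F)
  fps_mulV fps_unitP fps_inv_out.

Lemma fps_unitE f : (f \is a GRing.unit) = (fps_coef f 0 != 0).
Proof. by []. Qed.

Let fps_low f : f != 0 ->
  exists2 n, fps_coef f n != 0 & forall i, (i < n)%N -> fps_coef f i = 0.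
Proof.
move=> f_neq0; have exf : exists n, fps_coef f n != 0.
  apply/not_existsP => f0; case/eqP: f_neq0; apply: fpsP => n.
  by apply/eqP; apply: contrapT => /negP /f0.
case: (ex_minnP exf) => n fn min_n; exists n => // i lt_in.
by apply/eqP; apply: contraTT lt_in => /min_n; rewrite -leqNgt.
Qed.

Let fps_mulf_eq0 : GRing.integral_domain_axiom (fps F).
Proof.
move=> f g fg0; apply/norP => -[/fps_low[m fm f_lt] /fps_low[n gn g_lt]].
have /eqP := congr1 (fun h => fps_coef h (m + n)%N) fg0.
rewrite fps_coefM; have lt_m : (m < (m + n).+1)%N by rewrite ltnS leq_addr.
rewrite (bigD1 (Ordinal lt_m)) //= big1 ?addr0 => [|i].
  by rewrite addKn mulf_eq0 (negbTE fm) (negbTE gn).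
rewrite -val_eqE /= neq_ltn => /orP[/f_lt->|lt_mi]; first by rewrite mul0r.
rewrite g_lt ?mulr0 // ltn_subLR ?ltn_add2r //.
by rewrite -ltnS.
Qed.

HB.instance Definition _ :=
  GRing.ComUnitRing_isIntegral.Build (fps F) fps_mulf_eq0.

Definition fps_deriv f : fps F := FPS (fun n => fps_coef f n.+1 *+ n.+1).

(* [log f = \sum_(k >= 1) (-1)^(k+1) / k * (f - 1)^k], meant for [f_0 = 1] in
   characteristic 0.  Then [(f - 1)^k] has order at least [k], so that only
   the terms [k <= n] contribute to the coefficient of [y^n]. *)
Definition fps_log f : fps F :=
  FPS (fun n => \sum_(1 <= k < n.+1)
    (-1) ^+ k.+1 / k%:R * fps_coef ((f - 1) ^+ k) n).

(* [f = P / Q] for some polynomial [P], possibly not in lowest terms. *)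
Definition has_visible_den f (Q : {poly F}) : Prop :=
  exists P : {poly F}, f = fps_of_poly P / fps_of_poly Q.

Definition visible_num f (Q : {poly F}) : fps F := fps_of_poly Q * f.

End FpsRing.

Section Polytopes.
Variable R : realType.

(* Points of [R^(a m)] are [m x a] matrices; rows are the blocks. *)
Definition block_sum (m a : nat) (x : 'M[R]_(m, a)) (i : 'I_m) : R :=
  \sum_(j < a) x i j.

Definition cyclic_polytope (m a : nat) : set 'M[R]_(m, a) :=
  [set x : 'M[R]_(m, a) | (forall i j, 0 <= x i j) /\
           (forall i, block_sum x i + block_sum x (ordS i) <= 1)].

Definition path_polytope (m a : nat) : set 'M[R]_(m, a) :=
  [set x : 'M[R]_(m, a) | [/\ forall i j, 0 <= x i j,
               forall i i' : 'I_m, i' = i.+1 :> nat ->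
                 block_sum x i + block_sum x i' <= 1
             & m = 1%N -> forall i, block_sum x i <= 1]].

Definition dilate (m a q : nat) (K : set 'M[R]_(m, a)) : set 'M[R]_(m, a) :=
  [set q%:R *: x | x in K].

Definition integer_points (m a : nat) : set 'M[R]_(m, a) :=
  [set x : 'M[R]_(m, a) | forall i j, x i j \is a Num.int].

(* [fset_set] is empty on infinite sets; the dilated polytopes are bounded, so
   the sets counted below are finite. *)
Definition lattice_count (m a q : nat) (K : set 'M[R]_(m, a)) : nat :=
  #|` fset_set (dilate q K `&` @integer_points m a)|.

Definition L_cyc (a m q : nat) : nat := lattice_count q (@cyclic_polytope m a).
Definition L_path (a m q : nat) : nat := lattice_count q (@path_polytope m a).

Definition path_gf (a q : nat) : fps rat :=
  FPS (fun n => (L_path a n.+1 q)%:R).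

Definition cyclic_gf (a q : nat) : fps rat :=
  FPS (fun n => (L_cyc a (n + 3) q)%:R).

End Polytopes.

Definition transfer_mx (a q : nat) : 'M[rat]_q.+1 :=
  \matrix_(r < q.+1, s < q.+1)
    (if (r + s <= q)%N then 'C(s + a - 1, a - 1)%:R else 0).

Definition visible_denominator (a q : nat) : {poly rat} :=
  \det (1%:M - 'X *: map_mx polyC (transfer_mx a q)).

Definition closed_walk_gf (a q : nat) : fps rat :=
  FPS (fun n => \tr (transfer_mx a q ^+ n.+1)).

(* Main.v *)
(* Recording a lattice point by its block sums [r_i], each attained by
   ['C(r_i + a - 1, a - 1)] blocks, turns the points of the dilated cyclic
   polytope into closed walks weighted by the transfer matrix [C], and those of
   the path polytope into walks starting at [0].  The walk series
   [S = \sum_k C^k y^k] inverts [I - y C], hence [\adj (I - y C) = Q S]: all the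
   entries of [Q S] are polynomials, and Jacobi's formula gives
   [Q' = - \tr (C \adj (I - y C)) = - Q Omega]. *)
Require Import Defs.
From mathcomp Require Import all_boot all_order all_algebra.
From mathcomp Require Import perm finmap.
From mathcomp Require Import classical_sets.
From mathcomp Require Import cardinality reals.

Import Order.TTheory GRing.Theory Num.Theory.
Local Open Scope ring_scope.

(** * Coefficients, derivatives and logarithms of power series *)

Lemma fps_coef_trunc {F : fieldType} (f : fps F) n i :
  (i <= n)%N -> fps_coef f i = (\poly_(k < n.+1) fps_coef f k)`_i.
Proof. by move=> le_in; rewrite coef_poly ltnS le_in. Qed.

(** A convolution at order [n] reads no later coefficients, so series can be traded for polynomial
    truncations. *)
Lemma fps_coefM_eq {F : fieldType} (f f' g g' : fps F) n :
  (forall i, (i <= n)%N -> fps_coef f i = fps_coef f' i) ->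
  (forall i, (i <= n)%N -> fps_coef g i = fps_coef g' i) ->
  fps_coef (f * g) n = fps_coef (f' * g') n.
Proof.
move=> ff' gg'; rewrite !fps_coefM; apply: eq_bigr => i _.
by rewrite ff' ?gg' ?leq_subr // -ltnS.
Qed.

Lemma fps_coef_mulX {F : fieldType} (f : fps F) n :
  fps_coef (fps_of_poly 'X * f) n = if n is k.+1 then fps_coef f k else 0.
Proof.
rewrite fps_coefM big_ord_recl /= coefX mul0r add0r.
case: n => [|n]; first by rewrite big_ord0.
rewrite big_ord_recl /= coefX mul1r big1 ?addr0 ?subn1 // => i _.
by rewrite /bump /= coefX mul0r.
Qed.

Lemma fps_coef_sum {F : fieldType} (I : Type) (r : seq I) (P : pred I)
    (E : I -> fps F) n :
  fps_coef (\sum_(i <- r | P i) E i) n = \sum_(i <- r | P i) fps_coef (E i) n.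
Proof. by elim/big_rec2: _ => // i x y _ <-. Qed.

Lemma fps_of_poly_sum {F : fieldType} (I : Type) (r : seq I) (P : pred I)
    (E : I -> {poly F}) :
  fps_of_poly (\sum_(i <- r | P i) E i) = \sum_(i <- r | P i) fps_of_poly (E i).
Proof. exact: raddf_sum. Qed.

Lemma fps_of_polyM {F : fieldType} (p r : {poly F}) :
  fps_of_poly (p * r) = fps_of_poly p * fps_of_poly r.
Proof. exact: rmorphM. Qed.

Lemma fps_coefCM {F : fieldType} (c : F) (f : fps F) n :
  fps_coef (fps_of_poly c%:P * f) n = c * fps_coef f n.
Proof.
rewrite fps_coefM big_ord_recl /= coefC eqxx subn0 big1 ?addr0 // => i _.
by rewrite coefC mul0r.
Qed.

(** Each coefficient involves finitely many coefficients of [f] and [g], so the Leibniz rule is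
    inherited from polynomials by truncation. *)
Lemma fps_derivM {F : fieldType} (f g : fps F) :
  fps_deriv (f * g) = fps_deriv f * g + f * fps_deriv g.
Proof.
(* The truncation keeps order [n.+1], which the derivative reads at order [n]. *)
apply: fpsP => n; pose t (h : fps F) := \poly_(k < n.+2) fps_coef h k.
have tE h i : (i <= n.+1)%N -> fps_coef h i = fps_coef (fps_of_poly (t h)) i.
  exact: fps_coef_trunc.
have dtE h i : (i <= n)%N ->
    fps_coef (fps_deriv h) i = fps_coef (fps_of_poly (t h)^`()) i.
  by move=> le_in; rewrite /= coef_deriv -[(t h)`_ _]tE.
rewrite fps_coefD.
rewrite (fps_coefM_eq (fps_deriv f) (fps_of_poly (t f)^`())
                      g (fps_of_poly (t g))) //; first last.
- by move=> i le_in; apply: tE; apply: leqW.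
- exact: dtE.
rewrite (fps_coefM_eq f (fps_of_poly (t f))
                      (fps_deriv g) (fps_of_poly (t g)^`())) //; first last.
- exact: dtE.
- by move=> i le_in; apply: tE; apply: leqW.
rewrite -[LHS]/(fps_coef (f * g) n.+1 *+ n.+1).
rewrite (fps_coefM_eq f (fps_of_poly (t f)) g (fps_of_poly (t g))); first last.
- exact: tE.
- exact: tE.
by rewrite -!rmorphM -fps_coefD -rmorphD /= -coef_deriv derivM.
Qed.

Lemma fps_derivX {F : fieldType} (f : fps F) n :
  fps_deriv (f ^+ n.+1) = (f ^+ n * fps_deriv f) *+ n.+1.
Proof.
elim: n => [|n IHn]; first by rewrite expr1 expr0 mul1r.
by rewrite exprSr fps_derivM IHn mulrnAl mulrAC -exprSr [RHS]mulrSr.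
Qed.

Lemma fps_deriv_poly {F : fieldType} (p : {poly F}) :
  fps_deriv (fps_of_poly p) = fps_of_poly p^`().
Proof. by apply: fpsP => n; rewrite /= coef_deriv. Qed.

Lemma fps_coefMn {F : fieldType} (f : fps F) k n :
  fps_coef (f *+ k) n = fps_coef f n *+ k.
Proof. by elim: k => // k IHk; rewrite !mulrS fps_coefD IHk. Qed.

(** This makes the remainder of a truncated geometric series in [- (f - 1)] invisible at low
    order. *)
Lemma fps_coefX_small {F : fieldType} (g : fps F) k n :
  fps_coef g 0 = 0 -> (n < k)%N -> fps_coef (g ^+ k) n = 0.
Proof.
move=> g0; elim: k n => // k IHk n lt_nk.
rewrite exprS fps_coefM big1 // => -[[|i] lt_in] _; first by rewrite g0 mul0r.
by rewrite IHk ?mulr0 //= -subSn // subSS (leq_trans (leq_subr _ _)).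
Qed.

(* As [f * \sum_(k < n.+1) (1 - f) ^+ k = 1 - (1 - f) ^+ n.+1], the truncated
   geometric series inverts [f] up to order [n]. *)
Lemma fps_deriv_log (f : fps rat) :
  fps_coef f 0 = 1 -> fps_deriv (fps_log f) = fps_deriv f / f.
Proof.
move=> f0; apply: fpsP => n.
have Uf : f \is a GRing.unit by rewrite fps_unitE f0 oner_neq0.
have g0 : fps_coef (f - 1) 0 = 0 by rewrite fps_coefD f0 /= subrr.
pose h := fps_deriv f * \sum_(k < n.+1) (- (f - 1)) ^+ k.
have hE : fps_deriv f / f = h + fps_deriv f / f * (- (f - 1)) ^+ n.+1.
  apply: (mulIr Uf); rewrite mulrDl divrK // -(mulrA (_ / _)) [_ ^+ _ * f]mulrC.
  rewrite mulrA divrK // /h -mulrA [_ * f]mulrC -mulrDr.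
  rewrite -[LHS]mulr1; congr (_ * _).
  rewrite -{1}[f]opprK -[X in - - X](subrK 1) opprD opprB.
  rewrite -[_ - _]opprB.
  suff -> : - (- (f - 1) - 1) * \sum_(k < n.+1) (- (f - 1)) ^+ k =
            1 - (- (f - 1)) ^+ n.+1 by rewrite subrK.
  by rewrite mulNr -subrX1 opprB.
rewrite hE fps_coefD [X in _ = _ + X]fps_coefM.
rewrite [X in _ = _ + X]big1 ?addr0; last first.
  move=> i _; rewrite (@fps_coefX_small _ _ n.+1) ?mulr0 ?ltnS ?leq_subr //.
  by rewrite fps_coefN g0 oppr0.
rewrite [LHS]/= big_add1 -pred_Sn big_mkord -sumrMnl /h mulr_sumr fps_coef_sum.
apply: eq_bigr => k _.
rewrite -mulrnAr.
(* The left side is a coefficient of the derivative of [(f - 1) ^+ k.+1]; the factor [k.+1] from the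
   power rule cancels the denominator in the logarithm. *)
have -> : fps_coef ((f - 1) ^+ k.+1) n.+1 *+ n.+1
        = fps_coef (fps_deriv f * (f - 1) ^+ k) n *+ k.+1.
  rewrite -[LHS]/(fps_coef (fps_deriv _) n) fps_derivX fps_coefMn mulrC.
  congr (fps_coef (_ * _) _ *+ _); apply: fpsP => i.
  by rewrite /= subr0.
rewrite -[X in _ / _ * X]mulr_natl mulrA divfK ?pnatr_eq0 //.
rewrite [(- _) ^+ k]exprNn mulrCA exprSr exprSr !mulrN1 opprK.
(* The sign is a rational number on one side and a series on the other; the parity of [k] reconciles
   them. *)
rewrite -(signr_odd _ k) -(signr_odd (fps rat) k).
by case: (odd k); rewrite ?expr1 ?expr0 ?mul1r // !mulN1r.
Qed.

(** * Derivative of a determinant *)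

Lemma deriv_prod {R : comNzRingType} {I : finType} (E : I -> {poly R}) :
  (\prod_i E i)^`() = \sum_i ((E i)^`() * \prod_(j | j != i) E j).
Proof.
(* Without duplicates, the filter [j != i] drops exactly one factor. *)
have gen (r : seq I) : uniq r -> (\prod_(i <- r) E i)^`() =
    \sum_(i <- r) ((E i)^`() * \prod_(j <- r | j != i) E j).
  elim: r => [|i r IHr]; first by rewrite !big_nil derivC.
  move=> /andP[ir Ur]; rewrite !big_cons derivM IHr // eqxx /= mulr_sumr.
  congr (_ * _ + _).
    rewrite big_seq_cond [RHS]big_seq_cond; apply: eq_bigl => j.
    by case: (boolP (j \in r)) => // jr; rewrite (memPn ir).
  rewrite big_seq [RHS]big_seq; apply: eq_bigr => j jr.
  by rewrite big_cons eq_sym (memPn ir) // mulrCA.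
exact: gen (index_enum_uniq I).
Qed.

(** Jacobi's formula. Differentiating the Leibniz expansion gives one determinant per differentiated
    row; expanding it along that row leaves the cofactors of [A]. *)
Lemma deriv_det {R : comNzRingType} {n : nat} (A : 'M[{poly R}]_n) :
  (\det A)^`() = \tr (map_mx (@deriv R) A *m \adj A).
Proof.
rewrite raddf_sum /=.
pose B i := \matrix_(k, j) if k == i then (A k j)^`() else A k j.
transitivity (\sum_i \det (B i)).
  rewrite exchange_big /=; apply: eq_bigr => s _.
  rewrite -mulr_sumr; transitivity ((-1) ^+ s * (\prod_i A i (s i))^`()).
    rewrite -signr_odd; case: odd; rewrite ?expr1 ?expr0 ?mul1r //.
    by rewrite !mulN1r derivN.
  rewrite deriv_prod; congr (_ * _); apply: eq_bigr => i _.
  rewrite [RHS](bigD1 i) //= mxE eqxx; congr (_ * _).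
  by apply: eq_bigr => k /negPf ki; rewrite mxE ki.
apply: eq_bigr => i _; rewrite (expand_det_row _ i) !mxE; apply: eq_bigr => j _.
rewrite !mxE eqxx /cofactor; congr (_ * (_ * \det _)).
by apply/matrixP => k l; rewrite !mxE eq_sym (negPf (neq_lift _ _)).
Qed.

(** * The generating series of walks *)

(** The resolvent [\sum_k C^k y^k], stored as a matrix of series so that matrix algebra over [fps F]
    applies. *)
Definition walk_mx {F : fieldType} {n : nat} (C : 'M[F]_n.+1) :
    'M[fps F]_n.+1 :=
  \matrix_(i, j) FPS (fun k => (C ^+ k) i j).

Definition walk_den {F : fieldType} {n : nat} (C : 'M[F]_n.+1) : {poly F} :=
  \det (1%:M - 'X *: map_mx polyC C).

Section WalkSeries.
Context {F : fieldType} {n : nat} (C : 'M[F]_n.+1).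
Let A : 'M[{poly F}]_n.+1 := 1%:M - 'X *: map_mx polyC C.
Let Af : 'M[fps F]_n.+1 := map_mx (@fps_of_poly F) A.
Let Cf : 'M[fps F]_n.+1 := map_mx (fun c => fps_of_poly c%:P) C.

Lemma walk_mxS i j k :
  fps_coef ((Cf *m walk_mx C) i j) k = (C ^+ k.+1) i j.
Proof.
rewrite exprS !mxE fps_coef_sum; apply: eq_bigr => l _.
by rewrite !mxE fps_coefCM.
Qed.

(** Telescoping: multiplication by [y C] reproduces the walk series without its constant term. *)
Lemma walk_mxK : Af *m walk_mx C = 1%:M.
Proof.
have -> : Af = 1%:M - fps_of_poly 'X *: Cf.
  by apply/matrixP => i j; rewrite !mxE rmorphB rmorphM rmorph_nat.
rewrite mulmxBl mul1mx -scalemxAl; apply/eqP; rewrite subr_eq; apply/eqP.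
apply/matrixP => i j; apply: fpsP => k.
rewrite [in LHS]mxE 3![in RHS]mxE fps_coefD fps_coef_mulX [LHS]/=.
case: k => [|k]; first by rewrite addr0 expr0 mxE; case: (i == j).
by rewrite walk_mxS; case: (i == j); rewrite /= add0r.
Qed.

(** The adjugate times [A] is scalar, and the walk series cancels [A] on the right. *)
Lemma adj_walk_den i j :
  fps_of_poly (\adj A i j) = fps_of_poly (walk_den C) * walk_mx C i j.
Proof.
have : map_mx (@fps_of_poly F) (\adj A) = fps_of_poly (walk_den C) *: walk_mx C.
  rewrite map_mx_adj -/Af -[LHS]mulmx1 -walk_mxK mulmxA mul_adj_mx.
  by rewrite mul_scalar_mx det_map_mx.
by move=> /matrixP/(_ i j); rewrite mxE [in X in _ = X -> _]mxE.
Qed.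

(** Evaluation at 0 commutes with the determinant and sends [A] to the identity. This makes the
    denominator invertible and its logarithm meaningful. *)
Lemma walk_den_coef0 : (walk_den C)`_0 = 1.
Proof.
rewrite -horner_coef0 -[_.[0]]/(horner_eval 0 _) -det_map_mx.
rewrite [X in \det X](_ : _ = 1%:M) ?det1 //.
apply/matrixP => i j; rewrite !mxE -[LHS]/(_.[0]) hornerD hornerN hornerM.
by rewrite hornerX mul0r subr0 hornerMn hornerE.
Qed.

Lemma walk_den_unit : fps_of_poly (walk_den C) \is a GRing.unit.
Proof. by rewrite fps_unitE /= walk_den_coef0 oner_neq0. Qed.

(** Row [ord0] of the transfer matrix will give the path generating function. *)
Lemma walk_den_row i :
  has_visible_den (FPS (fun k => \sum_j (C ^+ k.+1) i j)) (walk_den C).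
Proof.
(* The numerator is the sum of row [i] of [C * \adj A], since [\adj A] is the denominator times the
   walk series. *)
exists (\sum_j \sum_l (C i l)%:P * \adj A l j).
apply: (mulIr walk_den_unit); rewrite divrK ?walk_den_unit //.
rewrite [RHS]fps_of_poly_sum.
suff -> : FPS (fun k => \sum_j (C ^+ k.+1) i j) = \sum_j (Cf *m walk_mx C) i j.
  rewrite mulr_suml; apply: eq_bigr => j _.
  rewrite mxE [RHS]fps_of_poly_sum mulr_suml.
  apply: eq_bigr => l _; rewrite fps_of_polyM adj_walk_den mxE -mulrA.
  by congr (_ * _); rewrite mulrC.
apply: fpsP => k; rewrite [LHS]/= fps_coef_sum; apply: eq_bigr => j _.
by rewrite walk_mxS.
Qed.

Lemma walk_trace :
  fps_of_poly (walk_den C) * FPS (fun k => \tr (C ^+ k.+1)) =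
  - fps_of_poly (walk_den C)^`().
Proof.
(* Jacobi's formula applies, the entrywise derivative of [A] being [- C]. *)
have -> : (walk_den C)^`() = - \tr (map_mx polyC C *m \adj A).
  rewrite /walk_den deriv_det -/A -raddfN /= -mulNmx; congr (\tr (_ *m _)).
  apply/matrixP => i j; rewrite !mxE derivB derivM derivX derivC mulr0 addr0.
  by rewrite mul1r -polyC_natr derivC sub0r.
rewrite rmorphN opprK /mxtrace [RHS]fps_of_poly_sum.
have -> : FPS (fun k => \sum_i (C ^+ k.+1) i i) = \sum_i (Cf *m walk_mx C) i i.
  apply: fpsP => k; rewrite [LHS]/= fps_coef_sum; apply: eq_bigr => i _.
  by rewrite walk_mxS.
rewrite mulr_sumr; apply: eq_bigr => i _.
rewrite [in LHS]mxE [in RHS]mxE [RHS]fps_of_poly_sum mulr_sumr.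
by apply: eq_bigr => l _; rewrite fps_of_polyM adj_walk_den !mxE mulrCA.
Qed.
End WalkSeries.

(** * Lattice points *)

Lemma sum_tuple_cons {V : nmodType} {T : finType} {n : nat}
    (E : n.+1.-tuple T -> V) :
  \sum_t E t = \sum_x \sum_(t : n.-tuple T) E [tuple of x :: t].
Proof.
rewrite pair_big /=.
rewrite (reindex (fun p : T * n.-tuple T => [tuple of p.1 :: p.2])) //=.
exists (fun t => (thead t, [tuple of behead t])) => [[x t]|t] _ /=.
  by congr (_, _); apply: val_inj.
by rewrite -tuple_eta.
Qed.

(** Lattice points are indexed by finite functions, whereas induction on the length of a walk uses
    tuples. *)
Lemma sum_ffun_tuple {V : nmodType} {T : finType} {n : nat}
    (E : {ffun 'I_n -> T} -> V) :
  \sum_f E f = \sum_(t : n.-tuple T) E [ffun i => tnth t i].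
Proof.
rewrite (reindex (fun t : n.-tuple T => [ffun i => tnth t i])) //=.
exists (fun f : {ffun 'I_n -> T} => [tuple f i | i < n]) => [t|f] _.
  by apply: eq_from_tnth => i; rewrite tnth_mktuple ffunE.
by apply/ffunP => i; rewrite ffunE tnth_mktuple.
Qed.

(** Step [i] goes from entry [i] of [r :: u] to entry [i] of [u]. The end weight [g] covers both
    closed walks, with [g = C^~ r], and walks with a free end, with [g = 1]. *)
Lemma walk_sum {F : fieldType} {n : nat} (C : 'M[F]_n.+1) (g : 'I_n.+1 -> F)
    (d : 'I_n.+1) m r :
  \sum_(u : m.-tuple 'I_n.+1)
     (\prod_(i < m) C (nth d (r :: u) i) (nth d u i)) * g (last r u) =
  \sum_s (C ^+ m) r s * g s.
Proof.
elim: m r => [|m IHm] r.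
  rewrite (big_pred1 [tuple]) ?big_ord0 ?mul1r /=; last first.
    by move=> u; apply/esym/eqP/tuple0.
  rewrite (bigD1 r) //= expr0 mxE eqxx mul1r big1 ?addr0 // => s.
  by rewrite mxE eq_sym => /negPf->; rewrite mul0r.
rewrite sum_tuple_cons.
transitivity (\sum_x C r x * \sum_s (C ^+ m) x s * g s).
  apply: eq_bigr => x _; rewrite -IHm mulr_sumr; apply: eq_bigr => t _.
  by rewrite big_ord_recl /= mulrA.
under eq_bigr do rewrite mulr_sumr.
rewrite exchange_big; apply: eq_bigr => s _ /=.
by rewrite exprS mxE mulr_suml; apply: eq_bigr => x _; rewrite mulrA.
Qed.

Lemma mxtrace_walk {F : fieldType} {n : nat} (C : 'M[F]_n.+1) m :
  \tr (C ^+ m.+1) =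
  \sum_(f : {ffun 'I_m.+1 -> 'I_n.+1}) \prod_i C (f i) (f (ordS i)).
Proof.
rewrite sum_ffun_tuple sum_tuple_cons; apply: eq_bigr => r _.
rewrite exprSr mxE -(walk_sum C (C^~ r) r); apply: eq_bigr => t _.
(* The last factor is the closing step, the only one where [ordS] wraps around to the start [r]. *)
rewrite big_ord_recr /=; congr (_ * _).
  apply: eq_bigr => i _; rewrite !ffunE !(tnth_nth r) /= modn_small //.
  by rewrite ltnS.
rewrite !ffunE !(tnth_nth r) /= modnn /=; congr (C _ _).
by rewrite (last_nth r) size_tuple.
Qed.

Lemma mulmx_walk {F : fieldType} {n : nat} (C : 'M[F]_n.+1) m r :
  \sum_s (C ^+ m) r s =
  \sum_(f : {ffun 'I_m -> 'I_n.+1})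
    \prod_(i < m) C (nth r (r :: codom f) i) (f i).
Proof.
transitivity (\sum_s (C ^+ m) r s * 1).
  by under [RHS]eq_bigr do rewrite mulr1.
rewrite -(walk_sum _ (fun=> 1) r) sum_ffun_tuple; apply: eq_bigr => t _.
rewrite mulr1; apply: eq_bigr => i _; rewrite ffunE (tnth_nth r).
congr (C (nth r (r :: _) i) _).
by rewrite codomE (eq_map (ffunE _)) map_tnth_enum.
Qed.

(** Stars and bars. The entries of a composition of [k] are at most [k], so the bounds [k] and [q]
    on them give the same count. *)
Lemma card_ffun_sum {a q k : nat} : (0 < a)%N -> (k <= q)%N ->
  #|[pred v : {ffun 'I_a -> 'I_q.+1} | (\sum_j v j)%N == k]| =
  'C(k + a - 1, a - 1).
Proof.
case: a => // a _ le_kq; rewrite addnS !subn1 /= addnC -card_ord_partitions.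
pose h (t : a.+1.-tuple 'I_k.+1) : {ffun 'I_a.+1 -> 'I_q.+1} :=
  [ffun i => inord (tnth t i)].
have hE t i : h t i = tnth t i :> nat.
  by rewrite ffunE inordK // (leq_trans (ltn_ord _)).
rewrite -(card_imset _ (_ : injective h)); last first.
  move=> t t' /ffunP eq_h; apply: eq_from_tnth => i; apply: val_inj.
  by rewrite /= -!hE eq_h.
apply: eq_card => v; rewrite !inE; apply/eqP/imsetP => [sum_v|[t]].
  have v_le i : (v i <= k)%N by rewrite -sum_v (bigD1 i) //= leq_addr.
  exists [tuple inord (v i) | i < a.+1]; last first.
    by apply/ffunP => i; apply: ord_inj; rewrite hE tnth_mktuple inordK // ltnS.
  rewrite inE big_tuple; apply/eqP; rewrite -[RHS]sum_v; apply: eq_bigr => i _.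
  by rewrite tnth_mktuple inordK // ltnS.
rewrite inE big_tuple => /eqP <- ->; apply: eq_bigr => i _; exact: hE.
Qed.

(** Points are grouped by their block sums; once these are fixed, the blocks are chosen
    independently. The covering hypothesis keeps every block sum within ['I_q.+1]. *)
Lemma sum_block_sums {a q m : nat} (E : seq (seq 'I_m)) :
  (0 < a)%N -> (forall i, exists2 s, s \in E & i \in s) ->
  #|[pred f : {ffun 'I_m -> {ffun 'I_a -> 'I_q.+1}} |
      all (fun s => \sum_(i <- s) \sum_j f i j <= q)%N E]| =
  (\sum_(r : {ffun 'I_m -> 'I_q.+1} | all (fun s => \sum_(i <- s) r i <= q) E)
    \prod_i 'C(r i + a - 1, a - 1))%N.
Proof.
move=> a_gt0 coverE; rewrite -sum1_card.
have small (F : 'I_m -> nat) i : all (fun s => \sum_(i <- s) F i <= q)%N E ->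
    (F i < q.+1)%N.
  move=> /allP allE; have [s sE si] := coverE i.
  rewrite ltnS; apply: leq_trans (allE s sE).
  by rewrite (big_rem i) //= leq_addr.
(* [inord] falls back to a default on sums above [q]; by [pE] this never happens for admissible
   [f]. *)
pose p (f : {ffun 'I_m -> {ffun 'I_a -> 'I_q.+1}}) : {ffun 'I_m -> 'I_q.+1} :=
  [ffun i => inord (\sum_j f i j)%N].
pose P (r : {ffun 'I_m -> 'I_q.+1}) :=
  all (fun s => \sum_(i <- s) r i <= q)%N E.
have pE (f : {ffun 'I_m -> {ffun 'I_a -> 'I_q.+1}}) i :
    all (fun s => \sum_(i <- s) \sum_j f i j <= q)%N E ->
    p f i = (\sum_j f i j)%N :> nat.
  move=> allE; rewrite ffunE inordK //.
  exact: (small (fun i => \sum_j f i j)%N) allE.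
rewrite (partition_big p P) => [|f]; last first.
  rewrite inE /P => allE; apply: etrans (allE); apply: eq_all => s.
  by congr (_ <= q)%N; apply: eq_bigr => i _; apply: pE.
apply: eq_bigr => r Pr; pose N i := [pred v : {ffun 'I_a -> 'I_q.+1} |
  (\sum_j v j == r i)%N].
(* Distributivity turns the product of the block counts into a count of the family of choices. *)
transitivity (\sum_(f in family N) \prod_(i < m) 1)%N; last first.
  rewrite -(bigA_distr_big_dep (fun i => N i) (fun _ _ => 1%N)).
  by apply: eq_bigr => i _; rewrite sum1_card card_ffun_sum // -ltnS.
apply: eq_big => f; last by rewrite big1_eq.
apply/andP/familyP => [[Pf /eqP pf] i|Nf].
  by rewrite inE -pf pE.
have Nf' i : (\sum_j f i j)%N = r i by have := Nf i; rewrite inE => /eqP.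
have Pf : all (fun s => \sum_(i <- s) \sum_j f i j <= q)%N E.
  apply: etrans (Pr); apply: eq_all => s.
  by congr (_ <= q)%N; apply: eq_bigr => i _; apply: Nf'.
split; first by rewrite inE.
by apply/eqP/ffunP => i; apply: ord_inj; rewrite [LHS]pE.
Qed.

(** A common form for both polytopes: each list in [E] holds the block indices of one inequality.
    Lists keep repetitions, so [[:: i; ordS i]] is still right when [ordS i = i]. *)
Definition block_polytope {R : realType} {m a : nat} (E : seq (seq 'I_m)) :
    set 'M[R]_(m, a) :=
  [set x : 'M[R]_(m, a) | (forall i j, 0 <= x i j) /\
     {in E, forall s, \sum_(i <- s) block_sum x i <= 1}]%classic.

(** By nonnegativity and the covering hypothesis every coordinate of the dilate is at most [q], so
    its lattice points are encoded by functions into ['I_q.+1]. *)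
Lemma lattice_count_block {R : realType} {a q m : nat} (E : seq (seq 'I_m)) :
  (forall i, exists2 s, s \in E & i \in s) ->
  lattice_count q (block_polytope E : set 'M[R]_(m, a)) =
  #|[pred f : {ffun 'I_m -> {ffun 'I_a -> 'I_q.+1}} |
      all (fun s => \sum_(i <- s) \sum_j f i j <= q)%N E]|.
Proof.
move=> coverE; set D := [pred f | _].
pose G (f : {ffun 'I_m -> {ffun 'I_a -> 'I_q.+1}}) : 'M[R]_(m, a) :=
  \matrix_(i, j) (f i j)%:R.
have injG : injective G.
  move=> f g /matrixP eqG; apply/ffunP => i; apply/ffunP => j; apply: val_inj.
  by have /eqP := eqG i j; rewrite !mxE eqr_nat => /eqP.
have dilateE (x : 'M[R]_(m, a)) : dilate q (block_polytope E) x <->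
    (forall i j, 0 <= x i j) /\
    {in E, forall s, \sum_(i <- s) block_sum x i <= q%:R}.
  have sumZ (c : R) y s : \sum_(i <- s) block_sum (c *: y : 'M[R]_(m, a)) i =
      c * \sum_(i <- s) block_sum y i.
    rewrite mulr_sumr; apply: eq_bigr => i _; rewrite mulr_sumr.
    by apply: eq_bigr => j _; rewrite mxE.
  split=> [[y [y_ge0 yE] <-]|[x_ge0 xE]].
    split=> [i j|s sE]; first by rewrite mxE mulr_ge0.
    by rewrite sumZ -[leRHS]mulr1 ler_wpM2l ?yE.
  have [q0|q_gt0] := posnP q; last first.
    exists (q%:R^-1 *: x); last first.
      by rewrite scalerA divff ?scale1r // pnatr_eq0 -lt0n.
    split=> [i j|s sE]; first by rewrite mxE mulr_ge0 // invr_ge0.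
    by rewrite sumZ mulrC ler_pdivrMr ?mul1r ?xE // ltr0n.
  (* For [q = 0] no rescaling by the inverse of [q] is possible; the origin serves instead, as every
     coordinate of [x] is forced to vanish. *)
  exists 0.
    split=> [i j|s sE]; first by rewrite mxE.
    by rewrite -(scale0r 0) sumZ mul0r.
  rewrite scaler0; apply/matrixP => i j; rewrite mxE; apply/esym/eqP.
  rewrite eq_le x_ge0 andbT; have [s sE si] := coverE i.
  have := xE s sE; rewrite q0 (big_rem i) //=.
  rewrite {1}/block_sum (bigD1 j) //= -addrA.
  apply: le_trans; rewrite lerDl addr_ge0 ?sumr_ge0 // => k _.
  by rewrite sumr_ge0.
have sumG f s : \sum_(i <- s) block_sum (G f) i =
    (\sum_(i <- s) \sum_j f i j)%N%:R.
  rewrite natr_sum; apply: eq_bigr => i _; rewrite natr_sum.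
  by apply: eq_bigr => j _; rewrite mxE.
(* Exhibiting the points as a finite image rules out the default empty value of [fset_set]. *)
have -> : lattice_count q (block_polytope E : set 'M[R]_(m, a)) =
    #|` fset_set [set` [fset G f | f in D]%fset]%classic |.
  rewrite /lattice_count; congr #|` fset_set _|; apply/seteqP; split=> x /=.
    move=> [/dilateE[x_ge0 xE] x_int].
    have xN i j : x i j = (Num.truncn (x i j))%:R.
      by rewrite truncnK // natrEint x_ge0 x_int.
    have x_le i j : (Num.truncn (x i j) < q.+1)%N.
      rewrite ltnS -(ler_nat R) -xN; have [s sE si] := coverE i.
      apply: le_trans (xE s sE).
      rewrite (big_rem i) //= {1}/block_sum (bigD1 j) //= -addrA.
      by rewrite lerDl addr_ge0 ?sumr_ge0 // => k _; rewrite sumr_ge0.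
    pose f := [ffun i => [ffun j => inord (Num.truncn (x i j))]] :
      {ffun 'I_m -> {ffun 'I_a -> 'I_q.+1}}.
    have xG : x = G f.
      by apply/matrixP => i j; rewrite mxE !ffunE inordK.
    rewrite xG in_imfset // inE; apply/allP => s /xE.
    by rewrite xG sumG ler_nat.
  move=> /imfsetP[f /= Df ->]; split; last by move=> i j; rewrite mxE.
  apply/dilateE; split=> [i j|s sE]; first by rewrite mxE.
  by rewrite sumG ler_nat; move: Df; rewrite inE => /allP; apply.
by rewrite set_fsetK card_imfset //= cardE.
Qed.

Lemma prod_if {F : fieldType} {I : finType} (b : pred I) (w : I -> F) :
  \prod_i (if b i then w i else 0) = if [forall i, b i] then \prod_i w i else 0.
Proof.
case: ifP => [/forallP allb|/negbT/forallPn[i /negPf nbi]].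
  by apply: eq_bigr => i _; rewrite allb.
by rewrite (bigD1 i) //= nbi mul0r.
Qed.

(** Both sides are sums over cyclic sequences of block sums; the zero entries of the transfer matrix
    encode the inequalities. *)
Lemma L_cyc_trace {R : realType} {a q m : nat} : (1 <= a)%N -> (0 < m)%N ->
  (L_cyc R a m q)%:R = \tr (transfer_mx a q ^+ m).
Proof.
move=> a_ge1; case: m => // m _.
pose E := [seq [:: i; ordS i] | i <- enum 'I_m.+1].
have inE' i : [:: i; ordS i] \in E by apply/mapP; exists i; rewrite ?mem_enum.
have -> : L_cyc R a m.+1 q =
    lattice_count q (block_polytope E : set 'M[R]_(_, a)).
  congr lattice_count; apply/seteqP; split=> x [x_ge0 xE]; split=> //.
    by move=> _ /mapP[i _ ->]; rewrite big_cons big_seq1.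
  by move=> i; have := xE _ (inE' i); rewrite big_cons big_seq1.
have coverE i : exists2 s, s \in E & i \in s.
  by exists [:: i; ordS i]; rewrite ?inE' // mem_head.
rewrite lattice_count_block // sum_block_sums //.
rewrite natr_sum mxtrace_walk big_mkcond.
apply: eq_bigr => f _.
under [RHS]eq_bigr do rewrite mxE; rewrite prod_if.
have -> : all (fun s => \sum_(i <- s) f i <= q)%N E =
    [forall i, (f i + f (ordS i) <= q)%N].
  rewrite all_map; apply/allP/forallP => [H i|H i _].
    by have := H i (mem_enum _ _); rewrite /= big_cons big_seq1.
  by rewrite /= big_cons big_seq1.
(* The matrix weights a step by its target, the lattice count by the block itself; a cyclic shift of
   the index matches the two. *)
case: ifP => // _; rewrite natr_prod [LHS](reindex (@ordS m.+1)) //.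
exact: onW_bij (Bijective (@ordSK _) (@ord_predK _)).
Qed.

(* Row [0] of the transfer matrix allows every state [s <= q]: a path with [m]
   blocks is a walk with [m] steps from [0]. *)
Lemma L_path_sum {R : realType} {a q m : nat} : (1 <= a)%N -> (0 < m)%N ->
  (L_path R a m q)%:R = \sum_s (transfer_mx a q ^+ m) ord0 s.
Proof.
move=> a_ge1; case: m => // m _.
(* The constraint [R_0 <= 1] of [e 0] is implied by the others, unless there is
   a single block. *)
pose e (i : 'I_m.+1) := if i == 0%N :> nat then [:: i] else [:: inord i.-1; i].
pose E := [seq e i | i <- enum 'I_m.+1].
have inE' i : e i \in E by apply/mapP; exists i; rewrite ?mem_enum.
have -> : L_path R a m.+1 q =
    lattice_count q (block_polytope E : set 'M[R]_(_, a)).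
  congr lattice_count; apply/seteqP; split=> x.
    move=> [x_ge0 xP x1]; split=> // _ /mapP[i _ ->].
    have sum_ge0 k : 0 <= block_sum x k by apply: sumr_ge0.
    rewrite /e; case: ifP => [/eqP i0|/negbT i_neq0].
      rewrite big_seq1; case: (posnP m) => [m0|m_gt0].
        by apply: x1; rewrite m0.
      apply: le_trans (xP i (inord 1) _); first by rewrite lerDl.
      by rewrite i0 inordK.
    rewrite big_cons big_seq1; apply: xP.
    by rewrite inordK ?prednK ?lt0n // ltnW.
  move=> [x_ge0 xE]; split=> // [i i' i'E|[m0] i].
    have := xE _ (inE' i'); rewrite /e i'E /= big_cons big_seq1.
    by rewrite inord_val.
  have := xE _ (inE' i); rewrite /e [i == _ :> nat](_ : _ = true) ?big_seq1 //.
  rewrite -leqn0 -m0 -ltnS; exact: ltn_ord.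
have coverE i : exists2 s, s \in E & i \in s.
  by exists (e i); rewrite ?inE' // /e; case: ifP; rewrite !inE eqxx ?orbT.
rewrite lattice_count_block // sum_block_sums //.
rewrite natr_sum mulmx_walk big_mkcond.
apply: eq_bigr => f _.
under [RHS]eq_bigr do rewrite mxE; rewrite prod_if.
have -> : all (fun s => \sum_(i <- s) f i <= q)%N E =
    [forall i : 'I_m.+1, (nth ord0 (ord0 :: codom f) i + f i <= q)%N].
  (* The prepended [ord0] adds 0 at the first block, which gives the singleton [e 0] the same form
     as the pairs. *)
  have eE i : (\sum_(k <- e i) f k = nth ord0 (ord0 :: codom f) i + f i)%N.
    rewrite /e; case: i => [[|i] lt_im] /=; first by rewrite big_seq1.
    have i_lt : (i < m.+1)%N by apply: ltnW.
    rewrite big_cons big_seq1 codomE (nth_map ord0) ?size_enum_ord //.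
    congr (val (f _) + _)%N; apply: ord_inj.
    by rewrite inordK // nth_enum_ord.
  rewrite all_map; apply/allP/forallP => [H i|H i _].
    by have := H i (mem_enum _ _); rewrite /= eE.
  by rewrite /= eE.
by case: ifP => // _; rewrite natr_prod.
Qed.

Theorem theorem1p4 (R : realType) (a q : nat) (a_ge1 : (1 <= a)%N) :
  let C := transfer_mx a q in
  let Q := visible_denominator a q in
  let Omega := closed_walk_gf a q in
  let T1 := \tr C in
  let T2 := \tr (C ^+ 2) in
  [/\ forall m : nat, (3 <= m)%N -> (L_cyc R a m q)%:R = \tr (C ^+ m),
      Omega = - fps_deriv (fps_log (fps_of_poly Q)),
      Omega = - (fps_of_poly Q^`() / fps_of_poly Q),
      tofrac (cyclic_gf R a q) =
        tofrac (Omega - fps_of_poly T1%:P - fps_of_poly T2%:P * fps_of_poly 'X) /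
          tofrac (fps_of_poly 'X ^+ 2) :> {fraction (fps rat)}
    & [/\ has_visible_den (path_gf R a q) Q,
          has_visible_den Omega Q
        & visible_num Omega Q = fps_of_poly (- Q^`())]].
Proof.
move=> C Q Omega T1 T2.
have QE : Q = walk_den C by [].
have UQ : fps_of_poly Q \is a GRing.unit by apply: walk_den_unit.
have QOmega : fps_of_poly Q * Omega = - fps_of_poly Q^`() by apply: walk_trace.
have OmegaE : Omega = - (fps_of_poly Q^`() / fps_of_poly Q).
  by rewrite -mulNr -QOmega mulrC mulKr.
split=> //.
- by move=> m m_ge3; apply: L_cyc_trace => //; apply: leq_trans m_ge3.
- by rewrite fps_deriv_log ?fps_deriv_poly //; apply: walk_den_coef0.
(* As [y] is not a unit among power series, the quotient lives in the fraction field; clearing [y^2]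
   reduces it to a comparison of coefficients. *)
- have X2_neq0 : tofrac (fps_of_poly ('X : {poly rat}) ^+ 2) != 0.
    rewrite tofrac_eq0 expf_neq0 //; apply/eqP.
    by move=> /(congr1 (fun f => fps_coef f 1)) /=; rewrite coefX.
  apply: (mulIf X2_neq0); rewrite divfK // -rmorphM; congr tofrac.
  rewrite mulrC expr2 -mulrA; apply: fpsP => k.
  rewrite [RHS]fps_coefD [X in _ = X + _]fps_coefD !fps_coefN fps_coefCM.
  have polyE (p : {poly rat}) : fps_coef (fps_of_poly p) k = p`_k by [].
  rewrite !polyE coefC coefX fps_coef_mulX.
  (* Orders 0 and 1 are cancelled by [T1] and [T2]; beyond them the shift by two leaves the traces
     of the powers from the third on. *)
  case: k {polyE} => [|k]; first by rewrite mulr0 subr0 subrr.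
  rewrite fps_coef_mulX subr0; case: k => [|k].
    by rewrite mulr1 subrr.
  rewrite mulr0 subr0 -[RHS]/(\tr (C ^+ k.+3)) -addn3.
  by apply: L_cyc_trace; rewrite ?addn3.
split.
- have -> : path_gf R a q = FPS (fun k => \sum_j (C ^+ k.+1) ord0 j).
    by apply: fpsP => k; apply: L_path_sum.
  exact: walk_den_row.
- by exists (- Q^`()); rewrite rmorphN mulNr.
- by rewrite /visible_num QOmega rmorphN.
Qed.
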